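(* There is a universal constant $\varepsilon\in(0,1)$ (and $\varepsilon=1/3$ works) such that the following holds. Let $\mathbb{S}$ be a finite set, let $n\ge1$, let $\psi_{ij}\colon\mathbb{S}^2\to\mathbb{R}$ $(1\le i<j\le n)$ be arbitrary functions, and let $\pi$ be the probability measure on $\mathcal{X}=\mathbb{S}^n$ given by $$\pi(x):=\frac1C\exp\left\{\sum_{1\le i<j\le n}\psi_{ij}(x_i,x_j)\right\},$$ with $C$ the normalizing constant. Set $\psi_{ij}(\sigma,\tau):=\psi_{ji}(\tau,\sigma)$ for $i>j$ and $\psi_{ii}:=0$, and define $$J_{ij}:=\frac12\max_{(\sigma,\sigma',\tau)\in\mathbb{S}^3}|\psi_{ij}(\sigma,\tau)-\psi_{ij}(\sigma',\tau)|,\qquad \|J\|:=(|\mathbb{S}|-1)\max_{1\le i\le n}\left\{\sum_{j=1}^nJ_{ij}\right\}.$$ Whenever $\|J\|\le\varepsilon$, the transition matrix $P$ of the Glauber dynamics for $\pi$ satisfies $$\forall\mu\in\mathcal{P}(\mathcal{X}),\qquad H(\mu P\,|\,\pi)\le(1-\kappa)H(\mu\,|\,\pi),\qquad\text{with}\quad\kappa:=\frac{1-\|J\|}{n}.$$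
   Context: The Glauber dynamics for $\pi$ is the Markov chain on $\mathcal{X}$ with transition matrix $P(x,y):=\frac1n\sum_{i=1}^n\sum_{\sigma\in\mathbb{S}}\pi_i(\sigma|x)\mathbf{1}_{(y=x^{i,\sigma})}$, where $x^{i,\sigma}$ is obtained from $x$ by replacing the $i$-th coordinate with $\sigma$, and $\pi_i(\sigma|x):=\pi(x^{i,\sigma})/\sum_{\sigma'\in\mathbb{S}}\pi(x^{i,\sigma'})$. $\mathcal{P}(\mathcal{X})$ is the set of probability measures on $\mathcal{X}$, and $H(\mu\,|\,\pi):=\sum_x\mu(x)\log(\mu(x)/\pi(x))$ is the relative entropy (with $0\log0=0$). *)

(* Defs.v *)
(* MathComp / MathComp-Analysis *)
From HB Require Import structures.
From mathcomp Require Import all_boot all_order all_algebra.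
From mathcomp Require Import all_classical all_reals all_analysis.
Set Implicit Arguments.
Unset Strict Implicit.
Unset Printing Implicit Defensive.
Import Order.TTheory GRing.Theory Num.Theory.
Local Open Scope ring_scope.

Definition is_prob (R : realType) (T : finType) (mu : T -> R) : Prop :=
  (forall x, 0 <= mu x) /\ \sum_x mu x = 1.

(* For a strictly positive reference measure [pi]; the convention 0 log 0 = 0
   is automatic since [ln] is total. *)
Definition relative_entropy (R : realType) (T : finType) (mu pi : T -> R) : R :=
  \sum_x mu x * ln (mu x / pi x).

Definition measure_mul (R : realType) (T : finType) (mu : T -> R)
    (P : T -> T -> R) : T -> R :=
  fun y => \sum_x mu x * P x y.

Definition config (S : finType) (n : nat) : finType := {ffun 'I_n -> S}.

Definition set_coord (S : finType) (n : nat) (x : config S n) (i : 'I_n) (s : S)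
    : config S n :=
  [ffun j => if j == i then s else x j].

Definition cond_prob (R : realType) (S : finType) (n : nat)
    (pi : config S n -> R) (i : 'I_n) (s : S) (x : config S n) : R :=
  pi (set_coord x i s) / \sum_(s' : S) pi (set_coord x i s').

Definition glauber (R : realType) (S : finType) (n : nat)
    (pi : config S n -> R) (x y : config S n) : R :=
  n%:R^-1 * \sum_(i < n) \sum_(s : S)
    cond_prob pi i s x * (y == set_coord x i s)%:R.

(* A family (psi_ij)_{i<j} is encoded as a function on all pairs of indices;
   everything below depends only on its values at i < j. *)
Definition gibbs_weight (R : realType) (S : finType) (n : nat)
    (psi : 'I_n -> 'I_n -> S -> S -> R) (x : config S n) : R :=
  expR (\sum_(i < n) \sum_(j < n | (i < j)%N) psi i j (x i) (x j)).

Definition gibbs (R : realType) (S : finType) (n : nat)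
    (psi : 'I_n -> 'I_n -> S -> S -> R) (x : config S n) : R :=
  gibbs_weight psi x / \sum_(y : config S n) gibbs_weight psi y.

Definition sym_potential (R : realType) (S : finType) (n : nat)
    (psi : 'I_n -> 'I_n -> S -> S -> R) (i j : 'I_n) (s t : S) : R :=
  if (i < j)%N then psi i j s t else
  if (j < i)%N then psi j i t s else 0.

(* The maxima here and in [interaction_norm] are over nonnegative reals, so the
   default value 0 only matters for empty index sets. *)
Definition interaction (R : realType) (S : finType) (n : nat)
    (psi : 'I_n -> 'I_n -> S -> S -> R) (i j : 'I_n) : R :=
  2^-1 * \big[Num.max/0]_(p : S * S * S)
    `|sym_potential psi i j p.1.1 p.2 - sym_potential psi i j p.1.2 p.2|.

Definition interaction_norm (R : realType) (S : finType) (n : nat)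
    (psi : 'I_n -> 'I_n -> S -> S -> R) : R :=
  (#|S|%:R - 1) * \big[Num.max/0]_(i < n) \sum_(j < n) interaction psi i j.

(* Main.v *)
(* Write H for the relative entropy with respect to [pi].  For the distance
   counting differing sites, the Glauber operator P multiplies Lipschitz
   constants by at most lam = 1 - kappa, and the nonlinear map
   h |-> ln (P (exp h)) does not increase them: the latter because the
   disagreements created by a discrepancy at site j are, when ||J|| <= 1/3,
   less likely than any given outcome of an update at j.

   Let r > lam.  The functional mu |-> H(mu P) - r H(mu) is a difference of
   convex functions, and it does not decrease when exp(h) pi (normalised) is
   replaced by exp(h') pi with h' = P (ln (P (exp h))) / r, by two applications
   of the Donsker-Varadhan inequality.  The Lipschitz constant is multiplied by
   lam / r < 1, so iterating drives the measure to [pi], where the functional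
   is 0; hence the functional is nonpositive.  Let r decrease to lam. *)
Require Import Defs.
From HB Require Import structures.
From mathcomp Require Import all_boot all_order all_algebra.
From mathcomp Require Import all_classical all_reals all_analysis.
From mathcomp Require Import ring lra.
Set Implicit Arguments.
Unset Strict Implicit.
Unset Printing Implicit Defensive.
Import Order.TTheory GRing.Theory Num.Theory.
Import numFieldNormedType.Exports.
Local Open Scope ring_scope.

(** * Entropy contraction from Lipschitz contraction *)

Definition average (R : realType) (X : finType) (P : X -> X -> R) (g : X -> R)
    (x : X) : R :=
  \sum_y P x y * g y.

(** Differences are signed; for a symmetric [adj] this bounds them in absolute value. *)
Definition adj_lipschitz (R : realType) (X : finType) (adj : X -> X -> Prop)
    (L : R) (h : X -> R) : Prop :=
  forall x y, adj x y -> h y - h x <= L.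

Definition tilt (R : realType) (X : finType) (pi h : X -> R) (x : X) : R :=
  pi x * expR (h x) / \sum_y pi y * expR (h y).

Lemma ln_le_sub1 (R : realType) (x : R) : 0 < x -> ln x <= x - 1.
Proof.
move=> x0; have := @le_ln1Dx R (x - 1).
by rewrite [1 + _]addrC subrK ltrBrDr addNr => ->.
Qed.

Lemma weighted_sum_gt0 (R : realType) (X : finType) (pi f : X -> R) :
  is_prob pi -> (forall x, 0 < pi x) -> (forall x, 0 < f x) ->
  0 < \sum_x pi x * f x.
Proof.
move=> [_ pi1] pi0 f0.
have [x _|X0] := pickP (pred_of_simpl (@predT X)).
  rewrite (bigD1 x) //= ltr_pwDl ?mulr_gt0 ?sumr_ge0 // => y _.
  by rewrite mulr_ge0 // ltW.
by move: pi1 => /esym/eqP; rewrite big_pred0 // oner_eq0.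
Qed.

(** Sum ln u <= u - 1 at u = pi e^g / (Z mu) against [mu]: both pi e^g / Z and [mu] have mass 1, so
    the right side sums to 0. *)
Lemma donsker_varadhan (R : realType) (X : finType) (pi mu g : X -> R) :
  (forall x, 0 < pi x) -> is_prob pi -> is_prob mu ->
  \sum_x mu x * g x <=
    relative_entropy mu pi + ln (\sum_x pi x * expR (g x)).
Proof.
move=> pi0 ppi [mu0 mu1].
set Z := \sum_x pi x * _.
have Z0 : 0 < Z by apply: weighted_sum_gt0 => // x; exact: expR_gt0.
have term x : mu x * g x - mu x * ln (mu x / pi x) - mu x * ln Z <=
    pi x * expR (g x) / Z - mu x.
  have := mu0 x; rewrite le_eqVlt => /predU1P[<-|mx].
    by rewrite !mul0r !subr0 divr_ge0 ?mulr_ge0 ?expR_ge0 // ltW.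
  rewrite -!mulrBr.
  have := @ln_le_sub1 R (pi x * expR (g x) / Z / mu x).
  rewrite !divr_gt0 ?mulr_gt0 ?expR_gt0 // => /(_ isT) H.
  have E : g x - ln (mu x / pi x) - ln Z = ln (pi x * expR (g x) / Z / mu x).
    rewrite !(lnM, lnV) ?posrE ?mulr_gt0 ?invr_gt0 ?mulr_gt0 ?expR_gt0 //.
    rewrite expRK; lra.
  rewrite E; apply: (le_trans (ler_wpM2l (ltW mx) H)).
  by rewrite mulrBr mulr1 [X in X - _]mulrC divfK ?gt_eqF.
have : \sum_x (mu x * g x - mu x * ln (mu x / pi x) - mu x * ln Z) <=
    \sum_x (pi x * expR (g x) / Z - mu x) by apply: ler_sum => x _; exact: term.
rewrite !sumrB -!mulr_suml mu1 mul1r divff ?gt_eqF // subrr /relative_entropy.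
lra.
Qed.

Lemma relative_entropy_ge0 (R : realType) (X : finType) (pi mu : X -> R) :
  (forall x, 0 < pi x) -> is_prob pi -> is_prob mu ->
  0 <= relative_entropy mu pi.
Proof.
move=> pi0 ppi pmu; have := @donsker_varadhan R X pi mu (fun=> 0) pi0 ppi pmu.
rewrite big1 => [|x _]; last by rewrite mulr0.
under eq_bigr do rewrite expR0 mulr1.
by case: ppi => _ ->; rewrite ln1 addr0.
Qed.

Section reversible_chain.
Variables (R : realType) (X : finType) (pi : X -> R) (P : X -> X -> R).
Hypotheses (pi_gt0 : forall x, 0 < pi x) (pi_prob : is_prob pi).
Hypotheses (P_ge0 : forall x y, 0 <= P x y).
Hypotheses (P_sum : forall x, \sum_y P x y = 1).
Hypotheses (P_rev : forall x y, pi x * P x y = pi y * P y x).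

Lemma measure_mul_prob mu : is_prob mu -> is_prob (measure_mul mu P).
Proof.
move=> [mu0 mu1]; split=> [y|]; first by apply: sumr_ge0 => x _; rewrite mulr_ge0.
rewrite exchange_big /= -[RHS]mu1; apply: eq_bigr => x _.
by rewrite -mulr_sumr P_sum mulr1.
Qed.

Lemma sum_measure_mul mu g :
  \sum_y measure_mul mu P y * g y = \sum_x mu x * average P g x.
Proof.
under eq_bigr do rewrite mulr_suml.
rewrite exchange_big /=; apply: eq_bigr => x _.
by rewrite mulr_sumr; apply: eq_bigr => y _; rewrite mulrA.
Qed.

Lemma average_gt0 f : (forall x, 0 < f x) -> forall x, 0 < average P f x.
Proof.
move=> f0 x; rewrite lt0r sumr_ge0 ?andbT; last first.
  by move=> y _; rewrite mulr_ge0 // ltW.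
apply/negP; rewrite psumr_eq0; last by move=> y _; rewrite mulr_ge0 // ltW.
move=> /allP H; have : \sum_y P x y = 0.
  apply: big1 => y _; have /(_ (mem_index_enum y)) := H y.
  by rewrite mulf_eq0 (gt_eqF (f0 y)) orbF => /eqP.
by rewrite P_sum => /eqP; rewrite oner_eq0.
Qed.

Lemma tilt_prob h : is_prob (tilt pi h).
Proof.
have Z0 : 0 < \sum_y pi y * expR (h y).
  by apply: weighted_sum_gt0 => // x; exact: expR_gt0.
split=> [x|]; last by rewrite -mulr_suml divff ?gt_eqF.
by rewrite divr_ge0 ?mulr_ge0 ?expR_ge0 // ltW.
Qed.

Lemma relative_entropy_tilt h :
  relative_entropy (tilt pi h) pi =
    \sum_x tilt pi h x * h x - ln (\sum_y pi y * expR (h y)).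
Proof.
have [_ t1] := tilt_prob h.
have Z0 : 0 < \sum_y pi y * expR (h y).
  by apply: weighted_sum_gt0 => // x; exact: expR_gt0.
rewrite -[X in _ - X]mul1r -t1 mulr_suml -sumrB; apply: eq_bigr => x _.
rewrite -mulrBr; congr (_ * _).
have -> : tilt pi h x / pi x = expR (h x) / \sum_y pi y * expR (h y).
  by rewrite /tilt; field; rewrite !gt_eqF.
by rewrite lnM ?posrE ?invr_gt0 ?expR_gt0 // lnV ?posrE // expRK.
Qed.

(** By reversibility, the density of mu P with respect to [pi] is [average P] of the density of mu,
    which is e^h / Z for a tilt. *)
Lemma relative_entropy_tilt_mul h :
  relative_entropy (measure_mul (tilt pi h) P) pi =
    \sum_y measure_mul (tilt pi h) P y * ln (average P (expR \o h) y)
      - ln (\sum_y pi y * expR (h y)).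
Proof.
have [_ t1] := measure_mul_prob (tilt_prob h).
have Z0 : 0 < \sum_y pi y * expR (h y).
  by apply: weighted_sum_gt0 => // x; exact: expR_gt0.
rewrite -[X in _ - X]mul1r -t1 mulr_suml -sumrB; apply: eq_bigr => y _.
rewrite -mulrBr; congr (_ * _).
have -> : measure_mul (tilt pi h) P y / pi y =
    average P (expR \o h) y / \sum_y pi y * expR (h y).
  have -> : measure_mul (tilt pi h) P y =
      pi y * (average P (expR \o h) y / \sum_y pi y * expR (h y)).
    rewrite /average /measure_mul mulrA mulr_sumr mulr_suml.
    apply: eq_bigr => x _; rewrite [X in X / _]mulrA -P_rev /tilt /=.
    by ring.
  by rewrite mulrC mulKf ?gt_eqF.
rewrite lnM ?posrE ?invr_gt0 // ?lnV ?posrE //.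
by apply: average_gt0 => x; exact: expR_gt0.
Qed.

(* [H (mu P) - r H mu] is a difference of convex functionals of [mu];
   linearising the first one in the direction [g] and maximising over [mu]
   produces the tilted measure on the right. *)
Lemma dc_step (r : R) (mu g : X -> R) : 0 < r -> is_prob mu ->
  let nu := tilt pi (fun x => average P g x / r) in
  \sum_y measure_mul mu P y * g y - r * relative_entropy mu pi <=
  relative_entropy (measure_mul nu P) pi - r * relative_entropy nu pi
    + ln (\sum_y pi y * expR (g y)).
Proof.
move=> r0 pmu /=; set h := fun x => average P g x / r; set nu := tilt pi h.
have pnu : is_prob nu by exact: tilt_prob.
have E (m : X -> R) : \sum_y measure_mul m P y * g y = r * \sum_x m x * h x.
  rewrite sum_measure_mul mulr_sumr; apply: eq_bigr => x _.
  by rewrite /h; field; rewrite gt_eqF.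
have := donsker_varadhan h pi_gt0 pi_prob pmu.
have := donsker_varadhan g pi_gt0 pi_prob (measure_mul_prob pnu).
rewrite !E -/nu [relative_entropy nu pi]relative_entropy_tilt -/nu -/h.
set Z := ln (\sum_y pi y * expR (h y)); set Hm := relative_entropy mu pi.
move=> H1 H2; have := ler_wpM2l (ltW r0) H2; lra.
Qed.

(** [N] acts as the diameter of the graph [adj], [lam] as the Lipschitz contraction factor of the
    chain. *)
Variables (adj : X -> X -> Prop) (N lam : R).
Hypotheses (osc : forall L h, adj_lipschitz adj L h -> forall x y, h y - h x <= N * L).
Hypotheses (lam_ge0 : 0 <= lam).
Hypotheses (contraction : forall L g, adj_lipschitz adj L g ->
  adj_lipschitz adj (lam * L) (average P g)).
Hypotheses (curvature : forall L h, adj_lipschitz adj L h ->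
  adj_lipschitz adj L (fun x => ln (average P (expR \o h) x))).

(** As h oscillates by at most N L, P(e^h) is pointwise at most e^(N L) times the [pi]-mean of e^h.
    This starts the iteration. *)
Lemma relative_entropy_tilt_mul_le L h : adj_lipschitz adj L h ->
  relative_entropy (measure_mul (tilt pi h) P) pi <= N * L.
Proof.
move=> /osc Lh; rewrite relative_entropy_tilt_mul lerBlDr.
have [m0 m1] := measure_mul_prob (tilt_prob h).
have [_ pi1] := pi_prob.
rewrite -[leRHS]mul1r -m1 mulr_suml; apply: ler_sum => y _.
apply: ler_wpM2l => //; rewrite -ler_expR lnK; last first.
  by rewrite posrE average_gt0 // => x; exact: expR_gt0.
rewrite expRD lnK ?posrE; last first.
  by apply: weighted_sum_gt0 => // x; exact: expR_gt0.
have le1 x : expR (h x) <= expR (N * L) * \sum_z pi z * expR (h z).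
  rewrite mulr_sumr -[leLHS]mul1r -pi1 mulr_suml; apply: ler_sum => z _.
  rewrite mulrCA ler_wpM2l ?(ltW (pi_gt0 _)) // -expRD ler_expR.
  by have := Lh z x; lra.
rewrite -[leRHS]mul1r -(P_sum y) mulr_suml; apply: ler_sum => x _.
by apply: ler_wpM2l => /=.
Qed.

(** With g = ln P(e^h), the linearisation in [dc_step] is exact at the tilt by h, so the functional
    grows from h to [h1], whose Lipschitz constant is smaller by the factor lam / r. *)
Lemma relative_entropy_tilt_iter (r : R) k L h : 0 < r -> adj_lipschitz adj L h ->
  relative_entropy (measure_mul (tilt pi h) P) pi
    - r * relative_entropy (tilt pi h) pi <= N * L * (lam / r) ^+ k.
Proof.
move=> r0; elim: k L h => [|k IH] L h Lh.
  rewrite expr0 mulr1; have := relative_entropy_tilt_mul_le Lh.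
  have := relative_entropy_ge0 pi_gt0 pi_prob (tilt_prob h).
  by move=> /(mulr_ge0 (ltW r0)); lra.
have := dc_step (fun y => ln (average P (expR \o h) y)) r0 (tilt_prob h).
set h1 := fun x => average P _ x / r.
have /IH : adj_lipschitz adj (lam / r * L) h1.
  move=> x y xy; rewrite /h1 -mulrBl mulrAC ler_pM2r ?invr_gt0 //.
  exact: contraction (curvature Lh) _ _ xy.
rewrite /= (relative_entropy_tilt_mul h) exprS.
(* Both normalising constants agree because [pi] is invariant under P. *)
have -> : \sum_y pi y * expR (ln (average P (expR \o h) y)) =
    \sum_y pi y * expR (h y).
  transitivity (\sum_y pi y * average P (expR \o h) y).
    apply: eq_bigr => y _; rewrite lnK // posrE average_gt0 // => x.
    exact: expR_gt0.
  rewrite -sum_measure_mul; apply: eq_bigr => y _; congr (_ * _).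
  rewrite /measure_mul; under eq_bigr do rewrite P_rev.
  by rewrite -mulr_sumr P_sum mulr1.
move=> H1 H2; lra.
Qed.

Lemma relative_entropy_tilt_contract (r : R) L h : lam < r -> adj_lipschitz adj L h ->
  relative_entropy (measure_mul (tilt pi h) P) pi
    <= r * relative_entropy (tilt pi h) pi.
Proof.
move=> lr Lh; have r0 : 0 < r by exact: le_lt_trans lr.
rewrite -subr_le0.
(* The left side does not depend on k, so it is at most the limit 0 of the bounds. *)
have : `|lam / r| < 1 by rewrite ger0_norm ?divr_ge0 ?(ltW r0) // ltr_pdivrMr // mul1r.
move=> /(cvg_geometric (N * L)) c.
rewrite -(cvg_lim (@Rhausdorff R) c); apply: limr_ge; first by apply: cvgP c.
by apply: nearW => k; exact: relative_entropy_tilt_iter.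
Qed.

Lemma adj_lipschitz_ex (h : X -> R) : exists L, adj_lipschitz adj L h.
Proof.
exists (2 * \sum_x `|h x|) => x y _.
have le1 z : `|h z| <= \sum_x `|h x| by rewrite (bigD1 z) //= lerDl sumr_ge0.
have := le1 x; have := le1 y; rewrite !ler_norml; lra.
Qed.

(** One use of [dc_step] replaces [mu] by a tilt, to which the Lipschitz case applies since [X] is
    finite. *)
Lemma entropy_contraction mu : is_prob mu ->
  relative_entropy (measure_mul mu P) pi <= lam * relative_entropy mu pi.
Proof.
move=> pmu; have [m0 m1] := measure_mul_prob pmu.
have [_ pi1] := pi_prob.
have H0 := relative_entropy_ge0 pi_gt0 pi_prob pmu.
(* [mu] may vanish somewhere, so [mu P / pi] is shifted by [e] before taking
   its logarithm. *)
have shifted (r e : R) : lam < r -> 0 < e ->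
    relative_entropy (measure_mul mu P) pi <= r * relative_entropy mu pi + e.
  move=> lr e0; have r0 : 0 < r by exact: le_lt_trans lr.
  pose d y := measure_mul mu P y / pi y + e.
  have d0 y : 0 < d y by rewrite ltr_pwDr // divr_ge0 // ltW.
  have := dc_step (fun y => ln (d y)) r0 pmu.
  set h := fun x => average P _ x / r.
  have [L Lh] := adj_lipschitz_ex h.
  have := relative_entropy_tilt_contract lr Lh.
  (* The shift raises the normalising constant from 1 to 1 + e, which costs ln (1 + e) <= e. *)
  have -> : \sum_y pi y * expR (ln (d y)) = 1 + e.
    transitivity (\sum_y (measure_mul mu P y + pi y * e)).
      apply: eq_bigr => y _; rewrite lnK ?posrE // /d.
      by field; rewrite gt_eqF.
    by rewrite big_split /= -mulr_suml m1 pi1 mul1r.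
  have := le_ln1Dx (lt_trans (ltrN10 R) e0).
  suff : relative_entropy (measure_mul mu P) pi <=
      \sum_y measure_mul mu P y * ln (d y) by rewrite /=; lra.
  apply: ler_sum => y _; have := m0 y.
  rewrite le_eqVlt => /predU1P[<-|my]; first by rewrite !mul0r.
  by rewrite ler_wpM2l // ler_ln ?posrE ?divr_gt0 // lerDl ltW.
apply/ler_addgt0Pr => e e0.
(* Chosen so that s (H + 1) = e / 2; the 1 keeps the denominator positive when H = 0. *)
pose s := e / 2 / (relative_entropy mu pi + 1).
have s0 : 0 < s by rewrite !divr_gt0 // ltr_wpDl.
have := @shifted (lam + s) (e / 2).
rewrite ltrDl s0 divr_gt0 // => /(_ isT isT) /le_trans; apply.
rewrite mulrDl -addrA lerD2l -lerBrDr.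
have -> : e - e / 2 = s * (relative_entropy mu pi + 1).
  by rewrite /s divfK ?gt_eqF ?ltr_wpDl //; lra.
by rewrite ler_pM2l // lerDl.
Qed.

End reversible_chain.

(** * Total variation *)

(** This is tanh K <= K. The difference vanishes at 0 and has nonnegative derivative, by 1 - 2x <=
    e^(-2x). *)
Lemma expR_mul1B_le (R : realType) (K : R) : 0 <= K ->
  expR (2 * K) * (1 - K) <= 1 + K.
Proof.
move=> K0; rewrite -subr_ge0.
pose f (x : R) := 1 + x - expR (2 * x) * (1 - x).
have df (x : R) : is_derive x 1 f (1 - expR (2 * x) * (1 - 2 * x)).
  rewrite /f; apply: is_derive_eq.
  rewrite /GRing.scale /=; ring.
have cf : {within `[0, K], continuous f}%classic.
  apply: derivable_within_continuous => x _; exact: ex_derive.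
have <- : f 0 = 0 by rewrite /f mulr0 expR0 addr0 subr0 mulr1 subrr.
apply: (@ger0_derive1_ndecr R f 0 K _ _ cf 0 K (lexx _) K0 (lexx _)).
  by move=> x _; exact: ex_derive.
move=> x _; rewrite derive1E derive_val subr_ge0.
have := expR_ge1Dx (- (2 * x)) => /(ler_wpM2l (expR_ge0 (2 * x))).
by rewrite -expRD subrr expR0.
Qed.

(** The value 2 is (1 + K) / (1 - K) at K = 1/3. *)
Lemma expR2M_le2 (R : realType) (K : R) : K <= 1 / 3 -> expR (2 * K) <= 2.
Proof.
move=> K3; have := @expR_mul1B_le R (1 / 3) ltac:(lra).
have : expR (2 * K) <= expR (2 * (1 / 3)) by rewrite ler_expR; lra.
lra.
Qed.

(* The extremal case is [P / (1 - P) = t = expR (2 * K)] and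
   [Q / (1 - Q) = t^-1], where [P - Q = tanh K]. *)
Lemma odds_ratio_diff_le (R : realType) (P Q K : R) :
  0 <= P <= 1 -> 0 <= Q <= 1 -> 0 <= K ->
  P * (1 - Q) <= expR (4 * K) * (Q * (1 - P)) -> P - Q <= K.
Proof.
move=> P01 Q01 K0.
have -> : expR (4 * K) = expR (2 * K) * expR (2 * K).
  by rewrite -expRD; congr expR; ring.
have := expR_mul1B_le K0; have := expR_ge1Dx (2 * K).
set t := expR _ => t1 tK H.
set d := P - Q.
(* The hypothesis reads u <= t^2 v, whence (t^2 + 1)(u - v) <= (t^2 - 1)(u + v); and (1 + d^2) / 2 -
   (u + v) is the square (P + Q - 1)^2 / 2. *)
have H1 : d * (2 * (t * t + 1)) <= (t * t - 1) * (1 + d ^+ 2).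
  set u := P * (1 - Q); set v := Q * (1 - P).
  have E1 : d = u - v by rewrite /d /u /v; ring.
  have H2 : u + v <= (1 + d ^+ 2) / 2.
    have := sqr_ge0 (P + Q - 1); rewrite /u /v /d; nra.
  have t2 : 0 <= t * t - 1 by nra.
  have H3 := ler_wpM2l t2 H2.
  rewrite -/u -/v in H.
  rewrite [in leLHS]E1; nra.
rewrite leNgt; apply/negP => Kd.
have d1 : d <= 1 by rewrite /d; lra.
(* [H1] factored. The second factor is negative as d <= 1, so the first is nonpositive: d <= (t - 1)
   / (t + 1) = tanh K. *)
have H4 : 0 <= ((t + 1) * d - (t - 1)) * ((t - 1) * d - (t + 1)) by nra.
have H5 : (t - 1) * d - (t + 1) < 0 by nra.
have : (t + 1) * d - (t - 1) <= 0.
  by rewrite leNgt; apply/negP => H6; nra.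
nra.
Qed.

(** For [p] and [q] of equal mass this is half the l1 distance. *)
Definition tv_dist (R : realType) (S : finType) (p q : S -> R) : R :=
  \sum_s Num.max 0 (p s - q s).

Lemma tv_dist_ge0 (R : realType) (S : finType) (p q : S -> R) :
  0 <= tv_dist p q.
Proof. by apply: sumr_ge0 => s _; rewrite le_max lexx. Qed.

Lemma tv_dist_sym (R : realType) (S : finType) (p q : S -> R) :
  \sum_s p s = \sum_s q s -> tv_dist p q = tv_dist q p.
Proof.
move=> pq; apply/eqP; rewrite -subr_eq0 -sumrB; apply/eqP.
transitivity (\sum_s (p s - q s)); last by rewrite sumrB pq subrr.
apply: eq_bigr => s _; rewrite /Num.max; case: ifP; case: ifP; lra.
Qed.

(** Equal masses allow subtracting the minimum of [u]; then the terms with p < q are nonpositive and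
    the others carry a factor in [0, L]. *)
Lemma mean_diff_le (R : realType) (S : finType) (p q u : S -> R) (L : R) :
  \sum_s p s = \sum_s q s -> (forall s s', u s - u s' <= L) ->
  \sum_s p s * u s - \sum_s q s * u s <= tv_dist p q * L.
Proof.
move=> pq uL.
have [s0 _|S0] := pickP (pred_of_simpl (@predT S)); last first.
  by rewrite /tv_dist !big_pred0 // subrr mul0r.
case: (@Order.TotalTheory.arg_minP _ R S s0 predT u isT) => m _ um.
have -> : \sum_s p s * u s - \sum_s q s * u s =
    \sum_s (p s - q s) * (u s - u m).
  rewrite -sumrB; under [RHS]eq_bigr do rewrite mulrBr.
  have d0 : \sum_s (p s - q s) = 0 by rewrite sumrB pq subrr.
  rewrite [RHS]sumrB -mulr_suml d0 mul0r subr0.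
  by apply: eq_bigr => s _; rewrite mulrBl.
rewrite mulr_suml; apply: ler_sum => s _.
have := um s isT; have := uL s m; rewrite /Num.max; case: ifP; nra.
Qed.

(** The distance is p(A) - q(A) for A = {q < p}. In the odds ratio of p(A) and q(A) the normalising
    constants cancel, so it is at most e^(4K), one factor e^(2K) for each of the two weight
    comparisons. *)
Lemma tv_dist_normalize_le (R : realType) (S : finType) (w w' : S -> R)
    (K : R) :
  (forall s, 0 < w s) -> (forall s, 0 < w' s) -> 0 <= K ->
  (forall s, w s <= expR (2 * K) * w' s) ->
  (forall s, w' s <= expR (2 * K) * w s) ->
  tv_dist (fun s => w s / \sum_z w z) (fun s => w' s / \sum_z w' z) <= K.
Proof.
move=> w0 w'0 K0 ww' w'w.
have [s0 _|S0] := pickP (pred_of_simpl (@predT S)); last first.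
  by rewrite /tv_dist !big_pred0.
set W := \sum_z w z; set W' := \sum_z w' z.
have Wgt (v : S -> R) : (forall s, 0 < v s) -> 0 < \sum_s v s.
  move=> v0; rewrite (bigD1 s0) //= ltr_pwDl ?sumr_ge0 // => s _; exact: ltW.
have W0 : 0 < W by exact: Wgt.
have W'0 : 0 < W' by exact: Wgt.
pose p s := w s / W; pose q s := w' s / W'.
have p0 s : 0 < p s by rewrite divr_gt0.
have q0 s : 0 < q s by rewrite divr_gt0.
have p1 : \sum_s p s = 1 by rewrite -mulr_suml divff ?gt_eqF.
have q1 : \sum_s q s = 1 by rewrite -mulr_suml divff ?gt_eqF.
pose A s := q s < p s.
have split (v : S -> R) : \sum_s v s = 1 ->
    1 - \sum_(s | A s) v s = \sum_(s | ~~ A s) v s.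
  by move=> v1; rewrite -v1 (bigID A) /= addrAC subrr add0r.
have in01 (v : S -> R) : (forall s, 0 < v s) -> \sum_s v s = 1 ->
    0 <= \sum_(s | A s) v s <= 1.
  move=> v0 v1; rewrite sumr_ge0 /=; last by move=> s _; exact: ltW.
  by rewrite -subr_ge0 split // sumr_ge0 // => s _; exact: ltW.
have -> : tv_dist p q = \sum_(s | A s) p s - \sum_(s | A s) q s.
  rewrite -sumrB /tv_dist [RHS]big_mkcond; apply: eq_bigr => s _.
  by rewrite /Num.max subr_gt0.
apply: odds_ratio_diff_le => //; try exact: in01.
rewrite !split // !mulr_suml mulr_sumr; apply: ler_sum => s _.
rewrite !mulr_sumr; apply: ler_sum => s' _.
have -> : p s * q s' = w s * w' s' / (W * W').
  by rewrite /p /q; field; rewrite !gt_eqF.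
have -> : expR (4 * K) * (q s * p s') =
    (expR (2 * K) * w' s) * (expR (2 * K) * w s') / (W * W').
  have -> : expR (4 * K) = expR (2 * K) * expR (2 * K).
    by rewrite -expRD; congr expR; ring.
  by rewrite /p /q; field; rewrite !gt_eqF.
rewrite ler_pM2r ?invr_gt0 ?mulr_gt0 //.
by rewrite ler_pM // ltW.
Qed.

(** * Glauber dynamics *)

Section configurations.
Variables (S : finType) (n : nat).
Implicit Types (x y : config S n) (i j : 'I_n) (s t : S).

Lemma set_coord_same x i s : set_coord x i s i = s.
Proof. by rewrite ffunE eqxx. Qed.

Lemma set_coord_id x i : set_coord x i (x i) = x.
Proof. by apply/ffunP => k; rewrite ffunE; case: eqP => // ->. Qed.

Lemma set_coord_idem x i s t : set_coord (set_coord x i s) i t = set_coord x i t.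
Proof. by apply/ffunP => k; rewrite !ffunE; case: eqP. Qed.

Lemma set_coord_comm x i j s t : i != j ->
  set_coord (set_coord x i s) j t = set_coord (set_coord x j t) i s.
Proof.
move=> ij; apply/ffunP => k; rewrite !ffunE.
by case: (eqVneq k j) => // ->; rewrite eq_sym (negPf ij).
Qed.

(** The choice s = x i gives y = x; for n > 0 the relation is thus reflexive and its Lipschitz
    constants are nonnegative. *)
Definition one_site x y : Prop := exists i s, y = set_coord x i s.

Lemma one_site_osc (R : realType) (L : R) (h : config S n -> R) :
  adj_lipschitz one_site L h -> forall x y, h y - h x <= n%:R * L.
Proof.
move=> Lh x y.
(* Interpolation: [z k] follows y on the first k sites and x on the rest. *)
pose z k : config S n := [ffun j : 'I_n => if (j < k)%N then y j else x j].
suff H k : (k <= n)%N -> h (z k) - h x <= k%:R * L.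
  have := H n (leqnn n).
  have -> // : z n = y by apply/ffunP => j; rewrite ffunE ltn_ord.
elim: k => [_|k IH kn].
  have -> : z 0%N = x by apply/ffunP => j; rewrite ffunE ltn0.
  by rewrite subrr mul0r.
have := IH (ltnW kn); have := Lh (z k) (z k.+1).
rewrite -natr1 mulrDl mul1r => H.
suff /H : one_site (z k) (z k.+1) by lra.
exists (Ordinal kn), (y (Ordinal kn)); apply/ffunP => j.
rewrite !ffunE ltnS leq_eqVlt -val_eqE /=.
by case: (eqVneq (j : nat) k) => //= jk; congr (y _); apply: val_inj.
Qed.

End configurations.

Section glauber_chain.
Variables (R : realType) (S : finType) (n : nat) (pi : config S n -> R).
Hypotheses (n_gt0 : (0 < n)%N) (pi_gt0 : forall x, 0 < pi x).
Implicit Types (x y : config S n) (i j : 'I_n) (s t : S).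

Lemma sum_fiber_gt0 x i : 0 < \sum_s pi (set_coord x i s).
Proof.
rewrite (bigD1 (x i)) //= ltr_pwDl ?sumr_ge0 // => s _; exact: ltW.
Qed.

Lemma cond_prob_gt0 i s x : 0 < cond_prob pi i s x.
Proof. by rewrite divr_gt0 ?sum_fiber_gt0. Qed.

Lemma cond_prob_sum i x : \sum_s cond_prob pi i s x = 1.
Proof. by rewrite -mulr_suml divff // gt_eqF ?sum_fiber_gt0. Qed.

Lemma cond_prob_set_coord i s x t :
  cond_prob pi i s (set_coord x i t) = cond_prob pi i s x.
Proof.
rewrite /cond_prob set_coord_idem; congr (_ / _).
by apply: eq_bigr => s' _; rewrite set_coord_idem.
Qed.

Lemma average_glauber g x :
  average (glauber pi) g x =
    n%:R^-1 * \sum_(i < n) \sum_s cond_prob pi i s x * g (set_coord x i s).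
Proof.
rewrite /average /glauber; under eq_bigr do rewrite -mulrA mulr_suml.
rewrite -mulr_sumr exchange_big /=; congr (_ * _); apply: eq_bigr => i _.
under eq_bigr do rewrite mulr_suml.
rewrite exchange_big /=; apply: eq_bigr => s _.
rewrite (bigD1 (set_coord x i s)) //= eqxx mulr1 big1 ?addr0 // => y /negPf ->.
by rewrite mulr0 mul0r.
Qed.

Lemma glauber_ge0 x y : 0 <= glauber pi x y.
Proof.
rewrite mulr_ge0 ?invr_ge0 // sumr_ge0 // => i _; rewrite sumr_ge0 // => s _.
by rewrite mulr_ge0 // ltW // cond_prob_gt0.
Qed.

Lemma glauber_sum x : \sum_y glauber pi x y = 1.
Proof.
have := average_glauber (fun=> 1) x; rewrite /average.
under eq_bigr do rewrite mulr1; move=> ->.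
under eq_bigr do under eq_bigr do rewrite mulr1.
under eq_bigr do rewrite cond_prob_sum.
by rewrite sumr_const card_ord mulVf // pnatr_eq0 -lt0n.
Qed.

Lemma glauber_rev x y : pi x * glauber pi x y = pi y * glauber pi y x.
Proof.
rewrite /glauber mulrCA [RHS]mulrCA; congr (_ * _); rewrite !mulr_sumr.
apply: eq_bigr => i _.
have one z w : \sum_s cond_prob pi i s z * (w == set_coord z i s)%:R =
    cond_prob pi i (w i) z * (w == set_coord z i (w i))%:R.
  rewrite (bigD1 (w i)) //= big1 ?addr0 // => s sw.
  case: eqP => [E|]; last by rewrite mulr0.
  by case/eqP: sw; rewrite E set_coord_same.
rewrite !one; case: eqP => [E|xy]; case: eqP => [E'|yx]; first last.
- by rewrite !mulr0.
- by case: xy; rewrite E' set_coord_idem set_coord_id.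
- by case: yx; rewrite E set_coord_idem set_coord_id.
rewrite !mulr1 /cond_prob -E -E'.
have -> : \sum_s pi (set_coord y i s) = \sum_s pi (set_coord x i s).
  by apply: eq_bigr => s _; rewrite E set_coord_idem.
ring.
Qed.

(** A sum of Dobrushin influences: n times the expected number of disagreements created away from j
    by one optimally coupled update of two copies differing only at j. *)
Definition influence x j t : R :=
  \sum_(i < n | i != j) tv_dist
    (fun s => cond_prob pi i s (set_coord x j t)) (fun s => cond_prob pi i s x).

Lemma influence_ge0 x j t : 0 <= influence x j t.
Proof. by apply: sumr_ge0 => i _; exact: tv_dist_ge0. Qed.

(** Path coupling: updating j removes the discrepancy, the n - 1 other sites keep it, and new ones
    contribute at most rho, which gives (n - 1 + rho) / n. *)
Lemma glauber_contraction (rho L : R) g :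
  (forall x j t, t != x j -> influence x j t <= rho) ->
  0 <= rho -> adj_lipschitz (@one_site S n) L g ->
  adj_lipschitz (@one_site S n) ((1 - (1 - rho) / n%:R) * L) (average (glauber pi) g).
Proof.
move=> infl rho0 Lg x _ [j [t ->]].
have n0 : 0 < n%:R :> R by rewrite ltr0n.
have L0 : 0 <= L.
  have := Lg x x; rewrite subrr; apply.
  by exists (Ordinal n_gt0), (x (Ordinal n_gt0)); rewrite set_coord_id.
have n1 : 1 <= n%:R :> R by rewrite ler1n.
have [->|tx] := eqVneq t (x j).
  rewrite set_coord_id subrr mulr_ge0 // subr_ge0 ler_pdivrMr //; lra.
rewrite !average_glauber -mulrBr ler_pdivrMl //.
have -> : n%:R * ((1 - (1 - rho) / n%:R) * L) = (n%:R - 1 + rho) * L.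
  by field; rewrite gt_eqF.
rewrite -sumrB (bigD1 j) //=.
rewrite [X in X - _](_ : _ = \sum_s cond_prob pi j s x * g (set_coord x j s)).
  2: by apply: eq_bigr => s _; rewrite cond_prob_set_coord set_coord_idem.
rewrite subrr add0r.
pose tv i := tv_dist
  (fun s => cond_prob pi i s (set_coord x j t)) (fun s => cond_prob pi i s x).
(* For i != j, first the configuration changes (cost L), then the conditional law at i (cost tv i *
   L). *)
apply: (@le_trans _ _ (\sum_(i < n | i != j) (L + tv i * L))).
  apply: ler_sum => i ij.
  have H1 : \sum_s cond_prob pi i s (set_coord x j t) *
        g (set_coord (set_coord x j t) i s) -
      \sum_s cond_prob pi i s (set_coord x j t) * g (set_coord x i s) <= L.
    rewrite -sumrB -[leRHS]mul1r -(cond_prob_sum i (set_coord x j t)) mulr_suml.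
    apply: ler_sum => s _; rewrite -mulrBr ler_wpM2l ?(ltW (cond_prob_gt0 _ _ _)) //.
    by apply: Lg; exists j, t; rewrite set_coord_comm // eq_sym.
  have H2 : \sum_s cond_prob pi i s (set_coord x j t) * g (set_coord x i s) -
      \sum_s cond_prob pi i s x * g (set_coord x i s) <= tv i * L.
    apply: mean_diff_le; first by rewrite !cond_prob_sum.
    by move=> s s'; apply: Lg; exists i, s; rewrite set_coord_idem.
  by have := lerD H1 H2; rewrite addrA subrK.
rewrite big_split /= -mulr_suml sumr_const cardC1 card_ord mulrDl lerD //.
  by rewrite -[leLHS]mulr_natl -subn1 natrB.
by rewrite ler_wpM2r //; exact: infl.
Qed.

(* Coupling with no expansion: where the [i]-th coordinates of the two copies
   disagree, keep one of them and update the other at [j] so that both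
   remain one site apart; this is possible when the total mass of such
   disagreements is at most the probability of each value at [j]. *)
Lemma glauber_curvature (L : R) h :
  (forall x j t s, t != x j -> influence x j t <= cond_prob pi j s x) ->
  adj_lipschitz (@one_site S n) L h ->
  adj_lipschitz (@one_site S n) L
    (fun x => ln (average (glauber pi) (expR \o h) x)).
Proof.
move=> infl Lh x y xy; pose f := expR \o h.
have f0 z : 0 < f z by exact: expR_gt0.
have L0 : 0 <= L.
  have := Lh x x; rewrite subrr; apply.
  by exists (Ordinal n_gt0), (x (Ordinal n_gt0)); rewrite set_coord_id.
have avg0 z : 0 < average (glauber pi) f z.
  by apply: average_gt0 => // [u v|u]; [exact: glauber_ge0|exact: glauber_sum].
rewrite -/f lerBlDr -ler_expR expRD !lnK ?posrE //.
have e1 : 1 <= expR L by rewrite -expR0 ler_expR.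
have Lf u v : one_site u v -> f v <= expR L * f u.
  by move=> /Lh; rewrite /f /= -expRD ler_expR; lra.
case: xy => j [t ->] {y}; have [->|tx] := eqVneq t (x j).
  by rewrite set_coord_id ler_peMl // ltW.
set y := set_coord x j t.
rewrite !average_glauber mulrCA ler_pM2l ?invr_gt0 ?ltr0n //.
set D := influence x j t.
have fyx : f y <= expR L * f x by apply: Lf; exists j, t.
have xE : x = set_coord y j (x j) by rewrite /y set_coord_idem set_coord_id.
pose tv i := tv_dist
  (fun s => cond_prob pi i s y) (fun s => cond_prob pi i s x).
(* The common mass of the two laws at i is matched value by value. The excess in y is compared with
   f y and the excess in x with f x; both excesses have mass [tv i]. *)
have other i : i != j ->
    \sum_s cond_prob pi i s y * f (set_coord y i s) <=
    expR L * (\sum_s cond_prob pi i s x * f (set_coord x i s))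
      + tv i * (expR L * f y - f x).
  move=> ij.
  have -> : tv i * (expR L * f y - f x) = tv i * (expR L * f y) -
      tv_dist (fun s => cond_prob pi i s x)
        (fun s => cond_prob pi i s y) * f x.
    rewrite [X in _ - X * _]tv_dist_sym ?cond_prob_sum //.
    by rewrite mulrBr.
  rewrite mulr_sumr !mulr_suml -sumrB -big_split /=; apply: ler_sum => s _.
  have := cond_prob_gt0 i s x; have := cond_prob_gt0 i s y.
  move: (cond_prob pi i s y) (cond_prob pi i s x) => p q p0 q0.
  have h1 : f (set_coord y i s) <= expR L * f (set_coord x i s).
    by apply: Lf; exists j, t; rewrite set_coord_comm // eq_sym.
  have h2 : f (set_coord y i s) <= expR L * f y by apply: Lf; exists i, s.
  have h3 : f x <= expR L * f (set_coord x i s).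
    by apply: Lf; exists i, (x i); rewrite set_coord_idem set_coord_id.
  rewrite /Num.max !subr_gt0; case: (ltgtP q p) => [qp|pq|->].
  - have d0 : 0 <= p - q by lra.
    have := ler_wpM2l (ltW q0) h1; have := ler_wpM2l d0 h2; lra.
  - have d0 : 0 <= q - p by lra.
    have := ler_wpM2l (ltW p0) h1; have := ler_wpM2l d0 h3; lra.
  - by have := ler_wpM2l (ltW p0) h1; lra.
pose V := \sum_s cond_prob pi j s x * f (set_coord x j s).
have VE : \sum_s cond_prob pi j s y * f (set_coord y j s) = V.
  by apply: eq_bigr => s _; rewrite cond_prob_set_coord set_coord_idem.
(* An update of x at j yields x or y when the new value is x j or t; these values differ, and each
   has probability at least D. *)
have VD : D * (f x + f y) <= V.
  rewrite /V (bigD1 (x j)) //= (bigD1 t) //= addrA.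
  rewrite set_coord_id -/y ler_wpDr //.
    by rewrite sumr_ge0 // => s _; rewrite mulr_ge0 // ltW // cond_prob_gt0.
  by rewrite mulrDr lerD // ler_wpM2r ?(ltW (f0 _)) //; exact: infl.
have D0 : 0 <= D := influence_ge0 x j t.
rewrite (bigD1 j) //= VE [X in _ <= _ * X](bigD1 j) //= -/V.
have : \sum_(i < n | i != j) \sum_s cond_prob pi i s y * f (set_coord y i s) <=
    expR L * (\sum_(i < n | i != j)
                \sum_s cond_prob pi i s x * f (set_coord x i s))
      + D * (expR L * f y - f x).
  by rewrite mulr_sumr mulr_suml -big_split /=; apply: ler_sum => i; exact: other.
move: (\sum_(i < n | _) _) (\sum_(i < n | _) _) => A B AB.
(* The error D (e^L f y - f x) is at most (e^L - 1) D (f x + f y), because f y <= e^L f x; the slack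
   (e^L - 1) V at site j absorbs it. *)
have e1' : 0 <= expR L - 1 by lra.
have := ler_wpM2l e1' VD; have := ler_wpM2l D0 fyx; lra.
Qed.

End glauber_chain.

(** * Gibbs measures *)

Section gibbs_measure.
Variables (R : realType) (S : finType) (n : nat).
Variable (psi : 'I_n -> 'I_n -> S -> S -> R).
Implicit Types (x y : config S n) (i j k : 'I_n) (s t : S).

Lemma gibbs_gt0 x : 0 < gibbs psi x.
Proof.
rewrite divr_gt0 ?expR_gt0 // (bigD1 x) //= ltr_pwDl ?expR_gt0 //.
by rewrite sumr_ge0 // => y _; rewrite expR_ge0.
Qed.

Lemma gibbs_prob x : is_prob (gibbs psi).
Proof.
split=> [y|]; first by rewrite ltW ?gibbs_gt0.
rewrite -mulr_suml divff // gt_eqF // (bigD1 x) //= ltr_pwDl ?expR_gt0 //.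
by rewrite sumr_ge0 // => y _; rewrite expR_ge0.
Qed.

Lemma sym_potentialC i j s t : sym_potential psi i j s t = sym_potential psi j i t s.
Proof. by rewrite /sym_potential; case: ltngtP. Qed.

(** The term k = i is 0, so the value does not depend on [x i]. *)
Definition local_field i s x : R := \sum_k sym_potential psi i k s (x k).

(** The factor [c] gathers the pairs avoiding i; every other pair occurs once, in one of two orders,
    and [sym_potential] covers both. *)
Lemma gibbs_weight_local i x : exists c : R, 0 < c /\
  forall s, gibbs_weight psi (set_coord x i s) = expR (local_field i s x) * c.
Proof.
pose T (a b : 'I_n) y : R := if (a < b)%N then psi a b (y a) (y b) else 0.
exists (expR (\sum_(a | a != i) \sum_(b | b != i) T a b x)).
split=> [|s]; first exact: expR_gt0.
rewrite /gibbs_weight -expRD; congr expR; set y := set_coord x i s.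
transitivity (\sum_a \sum_b T a b y).
  by apply: eq_bigr => a _; rewrite big_mkcond.
rewrite (bigD1 i) //=.
under [X in _ + X]eq_bigr do rewrite (bigD1 i) //=.
rewrite big_split /= addrA; congr (_ + _); last first.
  apply: eq_bigr => a ai; apply: eq_bigr => b bi.
  by rewrite /T !ffunE (negPf ai) (negPf bi).
rewrite /local_field (bigD1 i) //= [X in _ = X](bigD1 i) //=.
rewrite /T /sym_potential ltnn !add0r -big_split /=; apply: eq_bigr => k ki.
rewrite set_coord_same ffunE (negPf ki).
by case: ltngtP => [||/val_inj ik]; rewrite ?addr0 ?add0r.
Qed.

Lemma cond_prob_gibbs i s x :
  cond_prob (gibbs psi) i s x =
    expR (local_field i s x) / \sum_t expR (local_field i t x).
Proof.
have [c [c0 wE]] := gibbs_weight_local i x.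
rewrite /cond_prob /gibbs; set Z := \sum_(y : config S n) gibbs_weight psi y.
rewrite wE; under eq_bigr do rewrite wE -mulrA.
have Z0 : 0 < Z.
  rewrite /Z (bigD1 x) //= ltr_pwDl ?expR_gt0 // sumr_ge0 // => y _.
  by rewrite expR_ge0.
have W0 : 0 < \sum_t expR (local_field i t x).
  by rewrite (bigD1 s) //= ltr_pwDl ?expR_gt0 // sumr_ge0 // => t _; rewrite expR_ge0.
by rewrite -mulr_suml; field; rewrite !gt_eqF.
Qed.

Lemma interaction_ge0 i j : 0 <= interaction psi i j.
Proof.
rewrite mulr_ge0 ?invr_ge0 //.
by elim/big_ind: _ => // a b a0 b0; rewrite le_max a0.
Qed.

Lemma sym_potential_diff_le i j s s' t :
  `|sym_potential psi i j s t - sym_potential psi i j s' t|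
    <= 2 * interaction psi i j.
Proof.
rewrite /interaction mulVKf ?pnatr_eq0 //.
exact: (@le_bigmax _ R (S * S * S)%type 0
  (fun p => `|sym_potential psi i j p.1.1 p.2 - sym_potential psi i j p.1.2 p.2|)
  (s, s', t)).
Qed.

Lemma local_field_diff_le j s s' x :
  local_field j s x <= 2 * (\sum_i interaction psi j i) + local_field j s' x.
Proof.
rewrite mulr_sumr -big_split /=; apply: ler_sum => i _.
by have := sym_potential_diff_le j i s s' (x i); rewrite ler_norml; lra.
Qed.

(** Only the term k = j changes. Symmetry moves the change to the first argument, so the coefficient
    belongs to row j and summing over i gives a row sum. *)
Lemma local_field_set_coord_le i j s t x :
  `|local_field i s (set_coord x j t) - local_field i s x|
    <= 2 * interaction psi j i.
Proof.
rewrite -sumrB (bigD1 j) //= big1 ?addr0 => [|k kj]; last first.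
  by rewrite ffunE (negPf kj) subrr.
rewrite set_coord_same !(sym_potentialC i j); exact: sym_potential_diff_le.
Qed.

Lemma tv_dist_gibbs_le i j t x :
  tv_dist (fun s => cond_prob (gibbs psi) i s (set_coord x j t))
    (fun s => cond_prob (gibbs psi) i s x) <= interaction psi j i.
Proof.
rewrite /tv_dist; under eq_bigr do rewrite !cond_prob_gibbs.
apply: tv_dist_normalize_le => [s|s||s|s]; rewrite ?expR_gt0 ?interaction_ge0 //;
  rewrite -expRD ler_expR; have := local_field_set_coord_le i j s t x;
  rewrite ler_norml; lra.
Qed.

Lemma influence_gibbs_le x j t :
  influence (gibbs psi) x j t <= \sum_i interaction psi j i.
Proof.
rewrite [leRHS](bigD1 j) //= ler_wpDl ?interaction_ge0 //.
apply: ler_sum => i _; exact: tv_dist_gibbs_le.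
Qed.

Lemma interaction_row_le j :
  (0 < #|S|)%N ->
  (#|S|%:R - 1) * (\sum_i interaction psi j i) <= interaction_norm psi.
Proof.
move=> S0; rewrite ler_wpM2l ?subr_ge0 ?ler1n //.
exact: (@le_bigmax _ R 'I_n 0 (fun i => \sum_j interaction psi i j)).
Qed.

(** Each of the a = |S| - 1 other values weighs at most e^(2K) times s, so the probability is at
    least 1 / (1 + a e^(2K)). Since K <= a K <= 1/3 and e^(2K) <= 2, K (1 + a e^(2K)) <= 1/3 + 2/3:
    this is where 1/3 enters. *)
Lemma cond_prob_gibbs_ge x j s : (1 < #|S|)%N -> interaction_norm psi <= 1 / 3 ->
  \sum_i interaction psi j i <= cond_prob (gibbs psi) j s x.
Proof.
move=> S1 J3; set K := \sum_i _; set a : R := #|S|%:R - 1.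
have a1 : 1 <= a by rewrite /a lerBrDr -(natrD _ 1 1) ler_nat.
have K0 : 0 <= K by apply: sumr_ge0 => i _; exact: interaction_ge0.
have aK : a * K <= 1 / 3 by apply: le_trans J3; exact: interaction_row_le (ltnW S1).
have K3 : K <= 1 / 3 by nra.
have e2 := expR2M_le2 K3.
rewrite cond_prob_gibbs; set w := fun t => expR (local_field j t x).
have w0 t : 0 < w t by exact: expR_gt0.
have W : \sum_t w t <= w s * (1 + a * expR (2 * K)).
  rewrite (bigD1 s) //= mulrDr mulr1 lerD2l.
  apply: (@le_trans _ _ (\sum_(t | t != s) w s * expR (2 * K))).
    apply: ler_sum => t _; rewrite /w mulrC -expRD ler_expR.
    exact: local_field_diff_le.
  rewrite sumr_const cardC1 -subn1 -[leLHS]mulr_natl natrB ?(ltnW S1) //.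
  by rewrite -/a mulrCA.
have W0 : 0 < \sum_t w t.
  by rewrite (bigD1 s) //= ltr_pwDl // sumr_ge0 // => t _; rewrite ltW.
rewrite ler_pdivlMr // (le_trans (ler_wpM2l K0 W)) // mulrCA.
rewrite ler_piMr ?(ltW (w0 s)) //.
have : a * K * expR (2 * K) <= 1 / 3 * 2 by rewrite ler_pM ?expR_ge0 ?mulr_ge0 //; lra.
lra.
Qed.

End gibbs_measure.

Theorem corollary6 (R : realType) :
  exists eps : R, [/\ 0 < eps, eps < 1, eps = 1 / 3 &
    forall (S : finType) (n : nat) (psi : 'I_n -> 'I_n -> S -> S -> R),
      (0 < n)%N ->
      interaction_norm psi <= eps ->
      let pi := gibbs psi in
      let kappa := (1 - interaction_norm psi) / n%:R in
      forall mu : config S n -> R, is_prob mu ->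
        relative_entropy (measure_mul mu (glauber pi)) pi
          <= (1 - kappa) * relative_entropy mu pi].
Proof.
exists (1 / 3); split; [lra|lra|by []|] => S n psi n0 J3 pi kappa mu pmu.
have [x0 _|X0] := pickP (pred_of_simpl (@predT (config S n))); last first.
  by rewrite /relative_entropy !big_pred0 // mulr0.
have cS : (0 < #|S|)%N by apply/card_gt0P; exists (x0 (Ordinal n0)).
(* The influence bounds concern distinct values t and x j only; these force |S| - 1 >= 1, so that
   row sums are at most [interaction_norm psi]. *)
have S2 (x : config S n) j t : t != x j -> (1 < #|S|)%N.
  by move=> tx; apply/card_gt1P; exists t, (x j).
have rho0 : 0 <= interaction_norm psi.
  apply: le_trans (interaction_row_le psi (Ordinal n0) cS).
  rewrite mulr_ge0 ?subr_ge0 ?ler1n // sumr_ge0 // => i _.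
  exact: interaction_ge0.
have pi0 := gibbs_gt0 psi.
apply: (@entropy_contraction R _ pi (glauber pi) pi0 (gibbs_prob psi x0)
  (glauber_ge0 pi0) (glauber_sum n0 pi0) (glauber_rev pi) (@one_site S n) n%:R)
  => //.
- exact: one_site_osc.
- rewrite subr_ge0 ler_pdivrMr ?ltr0n // mul1r.
  by apply: (@le_trans _ _ 1); [lra|rewrite ler1n].
- move=> L g; apply: glauber_contraction => // x j t tx.
  apply: le_trans (influence_gibbs_le psi x j t) _.
  apply: le_trans (interaction_row_le psi j cS).
  rewrite ler_peMl ?sumr_ge0 // => [i _|]; first exact: interaction_ge0.
  by rewrite lerBrDr -(natrD _ 1 1) ler_nat (S2 _ _ _ tx).
- move=> L h; apply: glauber_curvature => // x j t s tx.
  apply: le_trans (influence_gibbs_le psi x j t) _.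
  exact: cond_prob_gibbs_ge (S2 _ _ _ tx) J3.
Qed.
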